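(* Let $\Lambda$ be one of the logics $\mathsf{iSL}_{\mathsf a}$ and $\mathsf{iSL}^{+}_{\mathsf a}$. Let $\phi$ be any formula of $\mathbb L(\rightsquigarrow)$ and let $\widetilde q$ be any finite set of propositional variables. Let $$\nu:=|\{\psi\in\mathsf{Sub}(\phi)\mid \psi\text{ is a propositional variable, an implication, or a Lewis implication}\}|.$$ Then: 1. There is a formula $\exists \widetilde q\,\phi$ (the post-interpolant of $\phi$) such that: (a) $\mathsf{PV}(\exists\widetilde q\,\phi)\subseteq \mathsf{PV}(\phi)\setminus\widetilde q$; (b) for all formulas $\psi$ with $\mathsf{PV}(\psi)\cap\widetilde q=\emptyset$: $\Lambda\vdash\phi\to\psi$ if and only if $\Lambda\vdash \exists\widetilde q\,\phi\to\psi$; (c) $\mathfrak c(\exists\widetilde q\,\phi)\le 2\nu+2$. 2. There is a formula $\forall\widetilde q\,\phi$ (the pre-interpolant of $\phi$) such that: (a) $\mathsf{PV}(\forall\widetilde q\,\phi)\subseteq \mathsf{PV}(\phi)\setminus\widetilde q$; (b) for all formulas $\psi$ with $\mathsf{PV}(\psi)\cap\widetilde q=\emptyset$: $\Lambda\vdash\psi\to\phi$ if and only if $\Lambda\vdash\psi\to\forall\widetilde q\,\phi$; (c) $\mathfrak c(\forall\widetilde q\,\phi)\le 2\nu+1$.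
   Context: Formulas of $\mathbb L(\rightsquigarrow)$ are built from propositional variables $p_0,p_1,\dots$, constants $\top,\bot$, and binary connectives $\wedge,\vee,\to$ and $\rightsquigarrow$ (the Lewis arrow). A formula of the form $\psi\to\chi$ is an implication, one of the form $\psi\rightsquigarrow\chi$ is a Lewis implication. Abbreviation: $\Box\phi:=(\top\rightsquigarrow\phi)$. The system $\mathsf{HLC}^\sharp$ is axiomatised by all axioms and rules of intuitionistic propositional logic $\mathsf{IPC}$ (in the full language, including modus ponens), the rule $\mathsf N_{\mathsf a}$: from $\vdash\phi\to\psi$ infer $\vdash\phi\rightsquigarrow\psi$, and the axiom schemes - $((\phi\rightsquigarrow\psi)\wedge(\psi\rightsquigarrow\chi))\to(\phi\rightsquigarrow\chi)$, - $((\phi\rightsquigarrow\psi)\wedge(\phi\rightsquigarrow\chi))\to(\phi\rightsquigarrow(\psi\wedge\chi))$, - $((\phi\rightsquigarrow\chi)\wedge(\psi\rightsquigarrow\chi))\to((\phi\vee\psi)\rightsquigarrow\chi)$. $\mathsf{iSL}_{\mathsf a}$ is $\mathsf{HLC}^\sharp$ plus the axiom scheme $(\Box\phi\to\phi)\to\phi$ (with all rules applying to the extended system). $\mathsf{iSL}^+_{\mathsf a}$ is $\mathsf{iSL}_{\mathsf a}$ plus the axiom scheme $((\chi\wedge\phi)\rightsquigarrow\psi)\to(\chi\rightsquigarrow(\phi\to\psi))$. $\mathsf{PV}(\phi)$ is the set of propositional variables occurring in $\phi$; $\mathsf{Sub}(\phi)$ is the set of subformulas of $\phi$; $|X|$ is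 the cardinality of $X$. Complexity: $\mathfrak c(p)=\mathfrak c(\bot)=\mathfrak c(\top)=0$; $\mathfrak c(\psi\wedge\chi)=\mathfrak c(\psi\vee\chi)=\max(\mathfrak c(\psi),\mathfrak c(\chi))$; $\mathfrak c(\psi\to\chi)=\mathfrak c(\psi\rightsquigarrow\chi)=\max(\mathfrak c(\psi),\mathfrak c(\chi))+1$. *)

(* Defs.v *)
From HB Require Import structures.
From mathcomp Require Import all_boot finmap.

Set Implicit Arguments.
Unset Strict Implicit.
Unset Printing Implicit Defensive.

Local Open Scope fset_scope.

(* [Var i] is the propositional variable p_i; [Lewis] is the Lewis arrow.
   Negation is not primitive. *)
Inductive form : Type :=
| Var of nat
| Top
| Bot
| And of form & form
| Or of form & form
| Imp of form & form
| Lewis of form & form.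

Declare Scope lewis_scope.
Delimit Scope lewis_scope with L.
Bind Scope lewis_scope with form.
Notation "⊤" := Top : lewis_scope.
Notation "⊥" := Bot : lewis_scope.
Notation "A ∧ B" := (And A B) (at level 80, right associativity) : lewis_scope.
Notation "A ∨ B" := (Or A B) (at level 85, right associativity) : lewis_scope.
Notation "A ⟶ B" := (Imp A B) (at level 88, right associativity) : lewis_scope.
Notation "A ⤳ B" := (Lewis A B) (at level 87, no associativity) : lewis_scope.

Definition Box (A : form) : form := (⊤ ⤳ A)%L.

Fixpoint form_encode (A : form) : GenTree.tree nat :=
  match A with
  | Var i => GenTree.Leaf i
  | Top => GenTree.Node 0 [::]
  | Bot => GenTree.Node 1 [::]
  | And A B => GenTree.Node 2 [:: form_encode A; form_encode B]
  | Or A B => GenTree.Node 3 [:: form_encode A; form_encode B]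
  | Imp A B => GenTree.Node 4 [:: form_encode A; form_encode B]
  | Lewis A B => GenTree.Node 5 [:: form_encode A; form_encode B]
  end.

Fixpoint form_decode (t : GenTree.tree nat) : form :=
  match t with
  | GenTree.Leaf i => Var i
  | GenTree.Node 0 _ => Top
  | GenTree.Node 2 [:: a; b] => And (form_decode a) (form_decode b)
  | GenTree.Node 3 [:: a; b] => Or (form_decode a) (form_decode b)
  | GenTree.Node 4 [:: a; b] => Imp (form_decode a) (form_decode b)
  | GenTree.Node 5 [:: a; b] => Lewis (form_decode a) (form_decode b)
  | GenTree.Node _ _ => Bot
  end.

Lemma form_encodeK : cancel form_encode form_decode.
Proof. by elim=> //= A -> B ->. Qed.

HB.instance Definition _ := Countable.copy form (can_type form_encodeK).

Fixpoint PV (A : form) : {fset nat} :=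
  match A with
  | Var i => [fset i]
  | Top | Bot => fset0
  | And A B | Or A B | Imp A B | Lewis A B => PV A `|` PV B
  end.

Fixpoint subformulas (A : form) : {fset form} :=
  A |` match A with
       | Var _ | Top | Bot => fset0
       | And B C | Or B C | Imp B C | Lewis B C => subformulas B `|` subformulas C
       end.

Fixpoint complexity (A : form) : nat :=
  match A with
  | Var _ | Top | Bot => 0
  | And A B | Or A B => maxn (complexity A) (complexity B)
  | Imp A B | Lewis A B => (maxn (complexity A) (complexity B)).+1
  end.

Definition var_or_arrow (A : form) : bool :=
  match A with
  | Var _ | Imp _ _ | Lewis _ _ => true
  | Top | Bot | And _ _ | Or _ _ => false
  end.

Definition nu (A : form) : nat := #|` [fset B in subformulas A | var_or_arrow B] |.

(* Theorems of HLC♯ extended by the formulas in [Ax] as further axioms; both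
   rules apply to the extended system. HLC♯ itself is the case of empty [Ax]. *)
Inductive HLC_plus (Ax : form -> Prop) : form -> Prop :=
| ax_K A B : HLC_plus Ax (A ⟶ (B ⟶ A))
| ax_S A B C : HLC_plus Ax ((A ⟶ (B ⟶ C)) ⟶ ((A ⟶ B) ⟶ (A ⟶ C)))
| ax_and_l A B : HLC_plus Ax ((A ∧ B) ⟶ A)
| ax_and_r A B : HLC_plus Ax ((A ∧ B) ⟶ B)
| ax_and A B : HLC_plus Ax (A ⟶ (B ⟶ (A ∧ B)))
| ax_or_l A B : HLC_plus Ax (A ⟶ (A ∨ B))
| ax_or_r A B : HLC_plus Ax (B ⟶ (A ∨ B))
| ax_or A B C : HLC_plus Ax ((A ⟶ C) ⟶ ((B ⟶ C) ⟶ ((A ∨ B) ⟶ C)))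
| ax_bot A : HLC_plus Ax (⊥ ⟶ A)
| ax_top : HLC_plus Ax ⊤
| mp A B : HLC_plus Ax (A ⟶ B) -> HLC_plus Ax A -> HLC_plus Ax B
| rule_Na A B : HLC_plus Ax (A ⟶ B) -> HLC_plus Ax (A ⤳ B)
| ax_lewis_trans A B C :
    HLC_plus Ax (((A ⤳ B) ∧ (B ⤳ C)) ⟶ (A ⤳ C))
| ax_lewis_and A B C :
    HLC_plus Ax (((A ⤳ B) ∧ (A ⤳ C)) ⟶ (A ⤳ (B ∧ C)))
| ax_lewis_or A B C :
    HLC_plus Ax (((A ⤳ C) ∧ (B ⤳ C)) ⟶ ((A ∨ B) ⤳ C))
| ax_extra A : Ax A -> HLC_plus Ax A.

Inductive logic : Type := iSLa | iSLa_plus.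

Inductive extra_axiom : logic -> form -> Prop :=
| strong_Lob (L : logic) A : extra_axiom L ((Box A ⟶ A) ⟶ A)
| lewis_curry A B C :
    extra_axiom iSLa_plus (((C ∧ A) ⤳ B) ⟶ (C ⤳ (A ⟶ B))).

Definition provable (L : logic) : form -> Prop := HLC_plus (extra_axiom L).

Notation "L ⊢ A" := (provable L A%L) (at level 89, no associativity).

(* Main.v *)
Require Import Defs.
From mathcomp Require Import all_boot finmap.
From mathcomp Require Import boolp.

Set Implicit Arguments.
Unset Strict Implicit.
Unset Printing Implicit Defensive.

Local Open Scope fset_scope.

(** The proof is semantic.  Both logics are sound and complete for Kripke models
    with an intuitionistic order [le] and a conversely well-founded relation [R]
    inside it that interprets the Lewis arrow; for [iSLa_plus] the relation [R]
    also absorbs [le] on the right ([soundness], [completeness]).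

    Let [P] be the variables of [phi] outside [q].  For every [n] there is a
    finite list [layer P n] of formulas over [P] of complexity at most [n] such
    that two worlds agreeing on [layer P n.+1] can match each other's [le]- and
    [R]-successors up to agreement on [layer P n].  The post-interpolant is the
    conjunction of the consequences of [phi] in [layer P (2 * nu phi + 2)], the
    pre-interpolant the disjunction of those conjunctions from
    [layer P (2 * nu phi + 1)] that entail [phi].  They use the right variables
    and have the right complexity by construction.

    That they are strong enough rests on an amalgamation.  If the post-interpolant
    does not entail [psi], there is a world [m] in a model [M] forcing it and
    refuting [psi], and by the choice of the interpolant a world [k] in a model
    [K] that forces [phi] and agrees with [m] on [layer P (2 * nu phi + 1)].  The
    model [amalgam] combines [K] and [M] so that one of its worlds forces the same
    formulas without variables in [q] as [m] ([amalgam_proj]) and the same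
    subformulas of [phi] as [k] ([amalgam_forces]); hence [phi] does not entail
    [psi].  The bound comes from the number [rank k] of variables, implications
    and Lewis implications among the subformulas of [phi] that are false at [k].
    Going up in [K], either the same subformulas of [phi] stay true or the rank
    drops.  Each drop uses up two layers: one to follow a step of [M] in [K], and
    one to follow in [M] the step of [K] that refutes an implication.  As ranks do
    not exceed [nu phi], an agreement up to [2 * nu phi + 1] is enough.

    For the pre-interpolant, [m] forces [psi] and refutes the interpolant, which
    yields a world [k] refuting [phi] and forcing all formulas of
    [layer P (2 * nu phi + 1)] true at [m].  As this agreement is one-sided, [k]
    is matched only by a world above [m], and only up to [2 * nu phi].  That
    suffices when the rank of [k] is not maximal.  When it is, no variable or
    arrow among the subformulas of [phi] is true at [k], and a copy of a world of
    [M] in which the variables of [q] are false already behaves like [k]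
    ([copy_forces]). *)

(** * Deduction *)

Notation "A ⊑[ L ] B" := (provable L (Imp A B)) (at level 70, L at level 0).

Section Deduction.
Variable L : logic.
Local Notation "A ⊑ B" := (provable L (Imp A B)) (at level 70).
Implicit Types A B C D G : form.

Lemma ent_mp D A B : D ⊑ Imp A B -> D ⊑ A -> D ⊑ B.
Proof. by move=> h; apply: mp; apply: mp h; apply: ax_S. Qed.

Lemma ent_weak D A : provable L A -> D ⊑ A.
Proof. by apply: mp; apply: ax_K. Qed.

Lemma ent_refl A : A ⊑ A.
Proof.
by apply: (@ent_mp A (Imp A A)); [exact: ax_K | exact: ax_K].
Qed.

Lemma ent_trans B A C : A ⊑ B -> B ⊑ C -> A ⊑ C.
Proof. by move=> h /(ent_weak A) h'; apply: ent_mp h' h. Qed.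

Lemma ent_andl A B C : A ⊑ C -> And A B ⊑ C.
Proof. by apply: ent_trans; apply: ax_and_l. Qed.

Lemma ent_andr A B C : B ⊑ C -> And A B ⊑ C.
Proof. by apply: ent_trans; apply: ax_and_r. Qed.

Lemma ent_and D A B : D ⊑ A -> D ⊑ B -> D ⊑ And A B.
Proof. by move=> hA; apply: ent_mp; apply: ent_trans hA (ax_and _ _ _). Qed.

Lemma ent_orl D A B : D ⊑ A -> D ⊑ Or A B.
Proof. by move=> h; apply: ent_trans h (ax_or_l _ _ _). Qed.

Lemma ent_orr D A B : D ⊑ B -> D ⊑ Or A B.
Proof. by move=> h; apply: ent_trans h (ax_or_r _ _ _). Qed.

Lemma ent_or A B C : A ⊑ C -> B ⊑ C -> Or A B ⊑ C.
Proof. by move=> hA; apply: mp; apply: mp hA; apply: ax_or. Qed.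

Lemma ent_imp D A B : And D A ⊑ B -> D ⊑ Imp A B.
Proof.
move=> /(ent_weak A) h; apply: ent_trans (ax_and _ D A) _.
by apply: mp h; apply: ax_S.
Qed.

Lemma ent_unimp D A B : D ⊑ Imp A B -> And D A ⊑ B.
Proof.
by move=> h; apply: (@ent_mp _ A); [exact: ent_andl | exact: ax_and_r].
Qed.

Lemma ent_bot A : Bot ⊑ A. Proof. exact: ax_bot. Qed.

Lemma ent_top A : A ⊑ Top. Proof. exact/ent_weak/ax_top. Qed.

Lemma ent_distr A B C : And A (Or B C) ⊑ Or (And B A) C.
Proof.
have: Or B C ⊑ Imp A (Or (And B A) C).
  apply: ent_or; apply: ent_imp; first exact/ent_orl/ent_refl.
  exact/ent_orr/ent_andl/ent_refl.
move/ent_unimp; apply: ent_trans; apply: ent_and.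
  exact/ent_andr/ent_refl.
exact/ent_andl/ent_refl.
Qed.

Lemma lewis_ent D A B : A ⊑ B -> D ⊑ Lewis A B.
Proof. by move=> h; apply/ent_weak/rule_Na. Qed.

Lemma lewis_trans B D A C : D ⊑ Lewis A B -> D ⊑ Lewis B C -> D ⊑ Lewis A C.
Proof.
by move=> h1 h2; apply: ent_trans (ent_and h1 h2) (ax_lewis_trans _ _ _ _).
Qed.

Lemma lewis_and D A B C :
  D ⊑ Lewis A B -> D ⊑ Lewis A C -> D ⊑ Lewis A (And B C).
Proof.
by move=> h1 h2; apply: ent_trans (ent_and h1 h2) (ax_lewis_and _ _ _ _).
Qed.

Lemma lewis_or D A B C :
  D ⊑ Lewis A C -> D ⊑ Lewis B C -> D ⊑ Lewis (Or A B) C.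
Proof.
by move=> h1 h2; apply: ent_trans (ent_and h1 h2) (ax_lewis_or _ _ _ _).
Qed.

Lemma ent_lob D A : And D (Box A) ⊑ A -> D ⊑ A.
Proof.
move=> /ent_imp h; apply: ent_trans h _.
by apply: ax_extra; apply: strong_Lob.
Qed.

(** Apply [ent_lob] to [A ∧ Box A], whose box yields [Box A]. *)
Lemma ent_box A : A ⊑ Box A.
Proof.
suff h: A ⊑ And A (Box A) by apply: ent_trans h _; apply: ax_and_r.
apply: ent_lob; apply: ent_and; first exact/ent_andl/ent_refl.
apply: (@lewis_trans (And A (Box A))); first exact/ent_andr/ent_refl.
exact/lewis_ent/ent_andl/ent_refl.
Qed.

Lemma lewis_box D A B : D ⊑ B -> D ⊑ Lewis A B.
Proof.
move=> h; apply: (@lewis_trans Top); first exact/lewis_ent/ent_top.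
exact: ent_trans h (ent_box B).
Qed.

(** Under [Box (A ⤳ B)] the first premise and the side formula [A ⤳ B] are
    available behind the arrow, so [ent_lob] removes them. *)
Lemma lewis_lob D A B :
  D ⊑ Lewis (And D (And A (Lewis A B))) B -> D ⊑ Lewis A B.
Proof.
move=> h; apply: ent_lob.
apply: (@lewis_trans (And D (And A (Lewis A B)))); last exact: ent_andl.
apply: lewis_and; first exact/ent_andl/lewis_box/ent_refl.
apply: lewis_and; first exact/lewis_ent/ent_refl.
apply: (@lewis_trans Top); first exact/lewis_ent/ent_top.
exact/ent_andr/ent_refl.
Qed.

Lemma lewis_box_imp D A B :
  L = iSLa_plus -> D ⊑ Lewis A B -> D ⊑ Box (Imp A B).
Proof.
move=> eL h.
have : D ⊑ Lewis (And Top A) B.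
  by apply: (@lewis_trans A) => //; apply/lewis_ent/ent_andr/ent_refl.
move=> h'; apply: ent_trans h' _.
by rewrite eL; apply: ax_extra; apply: lewis_curry.
Qed.

End Deduction.

(** * Finite conjunctions and disjunctions *)

Definition bigAnd (s : seq form) : form := foldr And Top s.
Definition bigOr (s : seq form) : form := foldr Or Bot s.

Section Big.
Variable L : logic.
Local Notation "A ⊑ B" := (provable L (Imp A B)) (at level 70).
Implicit Types (A D : form) (s t : seq form).

Lemma bigAnd_ent A s : A \in s -> bigAnd s ⊑ A.
Proof.
elim: s => //= B s IH; rewrite inE => /predU1P[->|/IH h].
  exact/ent_andl/ent_refl.
exact: ent_andr.
Qed.

Lemma ent_bigOr A s : A \in s -> A ⊑ bigOr s.
Proof.
elim: s => //= B s IH; rewrite inE => /predU1P[->|/IH h].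
  exact/ent_orl/ent_refl.
exact: ent_orr.
Qed.

Lemma ent_bigAnd D s : (forall A, A \in s -> D ⊑ A) -> D ⊑ bigAnd s.
Proof.
elim: s => [|B s IH] h /=; first exact: ent_top.
by apply: ent_and; [apply: h|apply: IH => A As; apply: h];
  rewrite inE ?eqxx ?As ?orbT.
Qed.

Lemma bigOr_ent D s : (forall A, A \in s -> A ⊑ D) -> bigOr s ⊑ D.
Proof.
elim: s => [|B s IH] h /=; first exact: ent_bot.
by apply: ent_or; [apply: h|apply: IH => A As; apply: h];
  rewrite inE ?eqxx ?As ?orbT.
Qed.

Lemma bigAnd_sub s t : {subset s <= t} -> bigAnd t ⊑ bigAnd s.
Proof. by move=> st; apply: ent_bigAnd => A /st; apply: bigAnd_ent. Qed.

Lemma bigOr_sub s t : {subset s <= t} -> bigOr s ⊑ bigOr t.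
Proof. by move=> st; apply: bigOr_ent => A /st; apply: ent_bigOr. Qed.

End Big.

Lemma complexity_bigAnd n s :
  all (fun A => complexity A <= n)%N s -> (complexity (bigAnd s) <= n)%N.
Proof. by elim: s => //= A s IH /andP[hA /IH hs]; rewrite geq_max hA. Qed.

Lemma complexity_bigOr n s :
  all (fun A => complexity A <= n)%N s -> (complexity (bigOr s) <= n)%N.
Proof. by elim: s => //= A s IH /andP[hA /IH hs]; rewrite geq_max hA. Qed.

Lemma PV_bigAnd X s : all (fun A => PV A `<=` X) s -> PV (bigAnd s) `<=` X.
Proof.
by elim: s => [|A s IH] /=; rewrite ?fsub0set// fsubUset => /andP[-> /IH].
Qed.

Lemma PV_bigOr X s : all (fun A => PV A `<=` X) s -> PV (bigOr s) `<=` X.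
Proof.
by elim: s => [|A s IH] /=; rewrite ?fsub0set// fsubUset => /andP[-> /IH].
Qed.

(** * Kripke models *)

(** [R] interprets the Lewis arrow.  Its converse well-foundedness and its
    inclusion in [le] make the strong Löb scheme valid. *)
Record model (L : logic) := Model {
  world :> Type;
  le : world -> world -> Prop;
  R : world -> world -> Prop;
  holds : world -> nat -> Prop;
  le_refl : forall x, le x x;
  le_trans : forall y x z, le x y -> le y z -> le x z;
  leR : forall y x z, le x y -> R y z -> R x z;
  R_le : forall x y, R x y -> le x y;
  R_wf : well_founded (fun x y => R y x);
  Rle : L = iSLa_plus -> forall y x z, R x y -> le y z -> R x z;
  holds_le : forall x y i, le x y -> holds x i -> holds y i
}.
Arguments le {L m}.
Arguments R {L m}.
Arguments holds {L m}.

Section Forcing.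
Variables (L : logic).

Fixpoint forces (M : model L) (x : M) (A : form) : Prop :=
  match A with
  | Var i => holds x i
  | Top => True
  | Bot => False
  | And A B => forces x A /\ forces x B
  | Or A B => forces x A \/ forces x B
  | Imp A B => forall y, le x y -> forces y A -> forces y B
  | Lewis A B => forall y, R x y -> forces y A -> forces y B
  end.

Implicit Types (M : model L).

Lemma forces_le M (x y : M) A : le x y -> forces x A -> forces y A.
Proof.
move=> xy; elim: A => //=.
- by move=> i; apply: holds_le.
- by move=> A IHA B IHB [/IHA ? /IHB ?].
- by move=> A IHA B IHB [/IHA ?|/IHB ?]; [left|right].
- by move=> A _ B _ h z yz; apply/h/(le_trans xy).
- by move=> A _ B _ h z yz; apply/h/(leR xy).
Qed.

(** The induction on [R] uses that [R] is contained in [le], so that the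
    hypothesis is inherited by successors. *)
Lemma forces_lob M (x : M) A : forces x (Imp (Box A) A) -> forces x A.
Proof.
elim/(well_founded_ind (R_wf (m := M))): x => x IH h.
apply: (h x (le_refl x)) => y xy _; apply: (IH y xy).
exact: forces_le (R_le xy) h.
Qed.

End Forcing.

Lemma extra_forces L A (M : model L) (x : M) : extra_axiom L A -> forces x A.
Proof.
move=> ax; case: ax M x => [L' B|B C D] M x.
  by move=> y _; apply: forces_lob.
move=> y _ h z yz hD t zt hB; apply: h; last by split=> //; apply: forces_le hD.
exact: Rle yz zt.
Qed.

Lemma soundness L A (M : model L) (x : M) : provable L A -> forces x A.
Proof.
move=> pA; elim: pA x => {A} //=.
- by move=> A B x y _ hA z yz _; apply: forces_le hA.
- move=> A B C x y _ h1 z yz h2 t zt hA.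
  by apply: (h1 t (le_trans yz zt) hA t (le_refl _)); apply: h2.
- by move=> A B x y _ [].
- by move=> A B x y _ [].
- by move=> A B x y _ hA z yz hB; split=> //; apply: forces_le hA.
- by left.
- by right.
- move=> A B C x y _ h1 z yz h2 t zt [hA|hB]; last exact: h2.
  exact: h1 (le_trans yz zt) hA.
- by move=> A B _ h1 _ h2 x; apply: h1 (le_refl x) (h2 x).
- by move=> A B _ h x y xy; apply: h (R_le xy).
- by move=> A B C x y _ [h1 h2] z yz hA; exact: (h2 z yz (h1 z yz hA)).
- by move=> A B C x y _ [h1 h2] z yz hA; split; [apply: h1|apply: h2].
- by move=> A B C x y _ [h1 h2] z yz [hA|hB]; [apply: h1 hA|apply: h2 hB].
by move=> A ax x; apply: extra_forces.
Qed.

(** * Completeness *)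

(** Abstracts from [⊑] and from [fun A B => G ⊑ Lewis A B]: both kinds of
    successors that a canonical model needs come from the same saturation. *)
Record consequence (L : logic) (T : form -> form -> Prop) : Prop := {
  cons_ent : forall A B, A ⊑[L] B -> T A B;
  cons_trans : forall B A C, T A B -> T B C -> T A C;
  cons_and : forall A B C, T A B -> T A C -> T A (And B C);
  cons_or : forall A B C, T A C -> T B C -> T (Or A B) C
}.

Lemma ent_consequence L : consequence L (fun A B => A ⊑[L] B).
Proof.
split=> // [B A C|A B C|A B C]; [exact: ent_trans|exact: ent_and|exact: ent_or].
Qed.

Lemma lewis_consequence L G : consequence L (fun A B => G ⊑[L] Lewis A B).
Proof.
by split=> [A B|B A C|A B C|A B C];
  [exact: lewis_ent|exact: lewis_trans|exact: lewis_and|exact: lewis_or].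
Qed.

Section Saturation.
Variables (L : logic) (T : form -> form -> Prop).
Hypothesis Tcons : consequence L T.

Lemma cons_cut A C D : T (And A C) D -> T C (Or A D) -> T C D.
Proof.
move=> h1 h2; apply: (cons_trans Tcons (B := And C (Or A D))).
  by apply: (cons_and Tcons) => //; apply: (cons_ent Tcons); exact: ent_refl.
apply: (cons_trans Tcons (B := Or (And A C) D)).
  by apply: (cons_ent Tcons); exact: ent_distr.
by apply: (cons_or Tcons) => //; apply: (cons_ent Tcons); exact: ent_refl.
Qed.

(** By [cons_cut] every formula of [s] can be added on one of the two sides. *)
Lemma saturate_cover (s G D : seq form) : ~ T (bigAnd G) (bigOr D) ->
  exists G' D', [/\ {subset G <= G'}, {subset D <= D'},
    {subset s <= G' ++ D'} & ~ T (bigAnd G') (bigOr D')].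
Proof.
elim: s G D => [|A s IH] G D nT; first by exists G, D; split.
have [T1|/IH] := pselect (T (bigAnd (A :: G)) (bigOr D)).
  have [T2|/IH] := pselect (T (bigAnd G) (bigOr (A :: D))).
    by case: nT; apply: cons_cut T1 T2.
  move=> [G' [D' [GG DD sub n]]]; exists G', D'; split=> // B.
    by move=> BD; apply: DD; rewrite inE BD orbT.
  rewrite inE => /predU1P[->|/sub//].
  by rewrite mem_cat DD ?inE ?eqxx ?orbT.
move=> [G' [D' [GG DD sub n]]]; exists G', D'; split=> // B.
  by move=> BD; apply: GG; rewrite inE BD orbT.
rewrite inE => /predU1P[->|/sub//].
by rewrite mem_cat GG ?inE ?eqxx ?orbT.
Qed.

Lemma saturation (S : {fset form}) (G D : seq form) :
  ~ T (bigAnd G) (bigOr D) ->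
  exists w : {fset form}, [/\ w `<=` S, {in S, forall A, A \in G -> A \in w},
    {in D, forall A, A \notin w} & ~ T (bigAnd w) (bigOr (S `\` w))].
Proof.
move=> /(saturate_cover S)[G' [D' [GG DD sub n]]].
exists [fset A in S | A \in G']; split.
- by apply/fsubsetP => A; rewrite !inE => /andP[].
- by move=> A AS /GG AG; rewrite !inE/= AS AG.
- move=> A /DD AD; apply/negP; rewrite !inE => /andP[_ AG]; apply: n.
  apply: (cons_ent Tcons); apply: ent_trans (bigAnd_ent L AG) _.
  exact: ent_bigOr.
move=> h; apply: n; apply: (cons_trans Tcons _ (cons_trans Tcons h _)).
  by apply: (cons_ent Tcons); apply: bigAnd_sub => A; rewrite !inE => /andP[].
apply: (cons_ent Tcons); apply: bigOr_sub => A; rewrite !inE => /andP[+ AS].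
by rewrite AS/= => AG; have := sub _ AS; rewrite mem_cat (negPf AG).
Qed.

End Saturation.

(** The clause for the Lewis arrow asks for [B ⟶ C] because in [iSLa_plus] the
    formula [B ⤳ C] amounts to [Box (B ⟶ C)]. *)
Definition adequate (S : {fset form}) : Prop := forall A, A \in S ->
  match A with
  | And B C | Or B C | Imp B C => B \in S /\ C \in S
  | Lewis B C => [/\ B \in S, C \in S & Imp B C \in S]
  | _ => True
  end.

Fixpoint adequate_closure (A : form) : {fset form} :=
  match A with
  | Var _ | Top | Bot => [fset A]
  | And B C | Or B C | Imp B C =>
      A |` (adequate_closure B `|` adequate_closure C)
  | Lewis B C =>
      A |` (Imp B C |` (adequate_closure B `|` adequate_closure C))
  end.

Lemma adequate_closure_self A : A \in adequate_closure A.
Proof. by case: A => *; rewrite /= !inE eqxx. Qed.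

Lemma adequate_closureP A : adequate (adequate_closure A).
Proof.
have self := adequate_closure_self.
elim: A => [i|||B IB C IC|B IB C IC|B IB C IC|B IB C IC] D /=.
1-3: by rewrite inE => /eqP->.
1-3: rewrite !inE => /predU1P[->|/orP[/IB|/IC]];
  first (by split; rewrite !inE !self ?orbT);
  case: D => //= ? ? [*]; split; rewrite !inE; apply/orP; right;
    apply/orP; first [by left | by right].
rewrite !inE => /predU1P[->|/predU1P[->|/orP[/IB|/IC]]].
1-2: by split; rewrite !inE ?self ?eqxx ?orbT.
1-2: case: D => //= ? ? [*]; split; rewrite !inE; apply/orP; right;
    apply/orP; right; apply/orP; first [by left | by right].
Qed.

Section Canonical.
Variables (L : logic) (S : {fset form}).
Hypothesis S_adequate : adequate S.
Local Notation "A ⊑ B" := (provable L (Imp A B)) (at level 70).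

(** The worlds are the subsets of [S] that can be exactly the formulas of [S]
    true at some point. *)
Definition theory (w : {fset form}) : Prop :=
  w `<=` S /\ ~ (bigAnd w ⊑ bigOr (S `\` w)).

Definition canon : Type := {w : {fset form} | theory w}.
Implicit Types (w v u : canon).

Lemma theory_closed w A : A \in S -> bigAnd (sval w) ⊑ A -> A \in sval w.
Proof.
case: w => w [/= ws nw] AS h; apply: contrapT => /negP Aw; apply: nw.
by apply: ent_trans h _; apply: ent_bigOr; rewrite inE Aw.
Qed.

Lemma theory_mem w A : A \in sval w -> A \in S.
Proof. by case: w => w [/= /fsubsetP ws _] /ws. Qed.

Definition canon_le w v : Prop := sval w `<=` sval v.

(** A Lewis successor acquires a new formula, which makes [canon_R] conversely
    well-founded on the subsets of the finite set [S].  The last clause gives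
    [canon_R] its absorption of [canon_le] on the right for [iSLa_plus]: unlike
    the closure under [B ⤳ C], membership of [B ⟶ C] persists. *)
Definition canon_R w v : Prop :=
  [/\ sval w `<=` sval v, exists2 D, D \in sval v & D \notin sval w &
    forall B C, Lewis B C \in sval w ->
      (B \in sval v -> C \in sval v) /\ (L = iSLa_plus -> Imp B C \in sval v)].

Lemma canon_R_wf : well_founded (fun w v => canon_R v w).
Proof.
move=> w; have [n] := ubnP (#|` S `\` sval w|).
elim: n w => [w|n IH w]; [by rewrite ltn0 | rewrite ltnS => le_n].
apply: Acc_intro => v [wv [D Dv Dw] _]; apply: IH.
apply: leq_trans le_n; apply: fproper_ltn_card.
rewrite fproperE; apply/andP; split.
  apply/fsubsetP => A; rewrite !inE => /andP[Av ->]; rewrite andbT.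
  by apply: contra Av; apply/fsubsetP.
by apply/fsubsetPn; exists D; rewrite !inE ?Dw ?Dv ?(theory_mem Dv).
Qed.

Definition canonical : model L.
Proof.
refine (@Model L canon canon_le canon_R (fun w i => Var i \in sval w)
  _ _ _ _ canon_R_wf _ _).
- by move=> w; apply: fsubset_refl.
- by move=> v w u; apply: fsubset_trans.
- move=> v w u wv [vu [D Du Dv] vuL].
  split; first exact: fsubset_trans vu.
    by exists D => //; apply: contra Dv; apply/fsubsetP.
  by move=> B C /(fsubsetP wv); apply: vuL.
- by move=> w v [].
- move=> eL v w u [wv [D Dv Dw] wvL] vu.
  split; first exact: fsubset_trans vu.
    by exists D => //; apply: (fsubsetP vu).
  move=> B C /wvL[_ /(_ eL)/(fsubsetP vu) BC]; split=> // Bu.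
  have [_ CS] := S_adequate (theory_mem BC).
  apply: theory_closed => //; apply: (@ent_mp _ _ B); exact: bigAnd_ent.
- by move=> w v i /fsubsetP; apply.
Defined.

Lemma saturated_imp w B C : Imp B C \in S -> Imp B C \notin sval w ->
  exists v, [/\ canon_le w v, B \in sval v & C \notin sval v].
Proof.
move=> BCS nBC; have [BS CS] := S_adequate BCS.
have n : ~ (bigAnd (B :: sval w) ⊑ bigOr [:: C]).
  move=> h; move/negP: nBC; apply; apply: theory_closed => //.
  apply: ent_imp; apply: ent_trans (ent_trans h _); last first.
    by apply: bigOr_ent => A; rewrite inE => /eqP->; apply: ent_refl.
  by apply: ent_and; [exact/ent_andr/ent_refl|exact/ent_andl/ent_refl].
have [v [vS Gv Dv nv]] := saturation (ent_consequence L) S n.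
exists (exist _ v (conj vS nv)); split=> /=.
- apply/fsubsetP => A Aw; apply: Gv; first exact: theory_mem Aw.
  by rewrite inE Aw orbT.
- by apply: Gv => //; rewrite inE eqxx.
- by apply: Dv; rewrite inE.
Qed.

(** The successor is saturated for the relation [fun A B => ⋀w ⊑ A ⤳ B].  By
    [lewis_lob], [B ⤳ C] itself can be put into it as the new formula. *)
Lemma saturated_lewis w B C : Lewis B C \in S -> Lewis B C \notin sval w ->
  exists v, [/\ canon_R w v, B \in sval v & C \notin sval v].
Proof.
move=> BCS nBC; have [BS CS _] := S_adequate BCS.
have n : ~ (bigAnd (sval w) ⊑
            Lewis (bigAnd (B :: Lewis B C :: sval w)) (bigOr [:: C])).
  move=> h; move/negP: nBC; apply; apply: theory_closed => //.
  apply: lewis_lob; apply: lewis_trans (lewis_trans h _); apply: lewis_ent.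
    apply: ent_and; first exact/ent_andr/ent_andl/ent_refl.
    by apply: ent_and; [exact/ent_andr/ent_andr/ent_refl|exact/ent_andl/ent_refl].
  by apply: bigOr_ent => A; rewrite inE => /eqP->; apply: ent_refl.
have [v [vS Gv Dv nv]] :=
  saturation (lewis_consequence L (bigAnd (sval w))) S n.
have vT : theory v by split=> // h; apply/nv/lewis_ent.
have wv A : A \in sval w -> A \in v.
  move=> Aw; apply: Gv; first exact: theory_mem Aw.
  by rewrite !inE Aw !orbT.
have closed A A' : A' \in S -> A \in v ->
    bigAnd (sval w) ⊑ Lewis A A' -> A' \in v.
  move=> A'S Av h; apply: contrapT => /negP A'v; apply: nv.
  apply: (lewis_trans (lewis_ent _ (bigAnd_ent L Av))).
  by apply: (lewis_trans h); apply/lewis_ent/ent_bigOr; rewrite inE A'v.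
exists (exist _ v vT); split=> /=; last by apply: Dv; rewrite inE.
  split=> /=; first exact/fsubsetP.
    by exists (Lewis B C) => //; apply: Gv; rewrite // !inE eqxx orbT.
  move=> D E DEw; have [_ ES DES] := S_adequate (theory_mem DEw).
  split=> [Dv'|eL]; first by apply: closed Dv' _ => //; apply: bigAnd_ent.
  apply: contrapT => /negP DEv; apply: nv.
  apply: (lewis_trans (lewis_ent _ (ent_top _ _))).
  apply: (@lewis_trans _ (Imp D E)).
    by apply: (lewis_box_imp eL); apply: bigAnd_ent.
  by apply/lewis_ent/ent_bigOr; rewrite inE DEv.
by apply: Gv => //; rewrite inE eqxx.
Qed.

Lemma canonical_forces A w : A \in S ->
  @forces L canonical w A <-> A \in sval w.
Proof.
elim: A w => [i|||B IB C IC|B IB C IC|B IB C IC|B IB C IC] w AS //=.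
- by split=> // _; apply: theory_closed => //; apply: ent_top.
- split=> // h; case: (svalP w) => _; case.
  exact: ent_trans (bigAnd_ent L h) (ent_bot _ _).
- have [BS CS] := S_adequate AS; rewrite IB// IC//; split=> [[Bw Cw]|h].
    by apply: theory_closed => //; apply: ent_and; apply: bigAnd_ent.
  by split; apply: theory_closed => //; apply: ent_trans (bigAnd_ent L h) _;
    [exact: ax_and_l|exact: ax_and_r].
- have [BS CS] := S_adequate AS; rewrite IB// IC//; split=> [[h|h]|h].
  + by apply: theory_closed => //; apply/ent_orl/bigAnd_ent.
  + by apply: theory_closed => //; apply/ent_orr/bigAnd_ent.
  apply: contrapT => /not_orP[nB nC]; case: (svalP w) => _; case.
  apply: ent_trans (bigAnd_ent L h) _; apply: ent_or; apply: ent_bigOr.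
    by rewrite inE BS andbT; apply/negP.
  by rewrite inE CS andbT; apply/negP.
- have [BS CS] := S_adequate AS; split=> [h|h v wv].
    apply: contrapT => /negP /(saturated_imp AS)[v [wv /(IB v BS) Bv /negP]].
    by apply; apply/(IC v CS)/(h v wv).
  rewrite IB// IC// => Bv; apply: theory_closed => //.
  apply: (@ent_mp _ _ B); apply: bigAnd_ent => //.
  by move: h; apply/fsubsetP.
have [BS CS _] := S_adequate AS; split=> [h|h v wv].
  apply: contrapT => /negP /(saturated_lewis AS)[v [wv /(IB v BS) Bv /negP]].
  by apply; apply/(IC v CS)/(h v wv).
by rewrite IB// IC//; case: wv => _ _ /(_ _ _ h)[].
Qed.

End Canonical.

Lemma completeness L A B : ~ (A ⊑[L] B) ->
  exists (M : model L) (x : M), forces x A /\ ~ forces x B.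
Proof.
move=> nAB.
pose S := adequate_closure (And A B).
have adS : adequate S := @adequate_closureP _.
have [AS BS] : A \in S /\ B \in S by apply: (adS (And A B)); rewrite !inE eqxx.
have n : ~ (bigAnd [:: A] ⊑[L] bigOr [:: B]).
  move=> h; apply: nAB; apply: ent_trans (ent_trans h _).
    by apply: ent_and; [apply: ent_refl|apply: ent_top].
  by apply: ent_or; [apply: ent_refl|apply: ent_bot].
have [v [vS Gv Dv nv]] := saturation (ent_consequence L) S n.
exists (@canonical L S adS), (exist _ v (conj vS nv)).
rewrite !canonical_forces//=; split; first by apply: Gv => //; rewrite inE.
by apply/negP/Dv; rewrite inE.
Qed.

(** * Layered equivalence *)

Fixpoint sublists (s : seq form) : seq (seq form) :=
  if s is A :: s' then map (cons A) (sublists s') ++ sublists s' else [:: [::]].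

Lemma filter_sublists p s : filter p s \in sublists s.
Proof.
elim: s => //= A s IH; rewrite mem_cat; case: (p A); last by rewrite IH orbT.
by rewrite map_f.
Qed.

Lemma sublists_sub s t : t \in sublists s -> {subset t <= s}.
Proof.
elim: s t => [|A s IH] t /=; first by rewrite inE => /eqP->.
rewrite mem_cat => /orP[/mapP[t' /IH ts ->]|/IH ts] B.
  by rewrite !inE => /predU1P[->|/ts->]; rewrite ?eqxx ?orbT.
by rewrite inE => /ts->; rewrite orbT.
Qed.

(** Arrows from conjunctions to disjunctions of the previous layer suffice to
    describe the successors of a world up to that layer, so that there is no need
    to list all formulas of complexity [n] up to equivalence. *)
Fixpoint layer (P : seq nat) (n : nat) : seq form :=
  if n is n'.+1 then
    let S := sublists (layer P n') in
    layer P n' ++ [seq Imp (bigAnd s) (bigOr t) | s <- S, t <- S]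
               ++ [seq Lewis (bigAnd s) (bigOr t) | s <- S, t <- S]
  else [seq Var i | i <- P].

Section Layer.
Variable P : seq nat.

Lemma layer_mono n n' : (n <= n')%N -> {subset layer P n <= layer P n'}.
Proof.
move=> /subnKC <-; elim: (n' - n)%N => [|j IH] A; first by rewrite addn0.
by rewrite addnS /= mem_cat => /IH ->.
Qed.

Lemma layer_imp n p p' :
  Imp (bigAnd (filter p (layer P n))) (bigOr (filter p' (layer P n)))
    \in layer P n.+1.
Proof.
rewrite /= !mem_cat; apply/orP; right; apply/orP; left.
by apply/allpairsP; exists (filter p (layer P n), filter p' (layer P n));
  split; rewrite ?filter_sublists.
Qed.

Lemma layer_lewis n p p' :
  Lewis (bigAnd (filter p (layer P n))) (bigOr (filter p' (layer P n)))
    \in layer P n.+1.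
Proof.
rewrite /= !mem_cat; apply/orP; right; apply/orP; right.
by apply/allpairsP; exists (filter p (layer P n), filter p' (layer P n));
  split; rewrite ?filter_sublists.
Qed.

Lemma complexity_layer n A : A \in layer P n -> (complexity A <= n)%N.
Proof.
elim: n A => [|n IH] A /=; first by move=> /mapP[i _ ->].
have IH' s : s \in sublists (layer P n) -> all (fun A => complexity A <= n)%N s.
  by move=> /sublists_sub h; apply/allP => B /h /IH.
rewrite !mem_cat => /or3P[/IH/leqW//| |] /allpairsP[[s t] [/IH' hs /IH' ht ->]].
  by rewrite /= ltnS geq_max complexity_bigAnd ?complexity_bigOr.
by rewrite /= ltnS geq_max complexity_bigAnd ?complexity_bigOr.
Qed.

Lemma PV_layer (X : {fset nat}) n A :
  {subset P <= X} -> A \in layer P n -> PV A `<=` X.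
Proof.
move=> PX; elim: n A => [|n IH] A /=.
  by move=> /mapP[i /PX iX ->]; rewrite fsub1set.
have IH' s : s \in sublists (layer P n) -> all (fun A => PV A `<=` X) s.
  by move=> /sublists_sub h; apply/allP => B /h /IH.
rewrite !mem_cat => /or3P[/IH//| |] /allpairsP[[s t] [/IH' hs /IH' ht ->]].
  by rewrite /= fsubUset PV_bigAnd ?PV_bigOr.
by rewrite /= fsubUset PV_bigAnd ?PV_bigOr.
Qed.

End Layer.

Lemma forces_bigAnd L (M : model L) (x : M) s :
  forces x (bigAnd s) <-> (forall A, A \in s -> forces x A).
Proof.
elim: s => [|A s IH] /=; first by split.
rewrite IH; split=> [[hA hs] B|h].
  by rewrite inE => /predU1P[->|/hs].
by split=> [|B Bs]; apply: h; rewrite inE ?eqxx ?Bs ?orbT.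
Qed.

Lemma forces_bigOr L (M : model L) (x : M) s :
  forces x (bigOr s) <-> (exists2 A, A \in s & forces x A).
Proof.
elim: s => [|A s IH] /=; first by split=> // -[].
rewrite IH; split=> [[hA|[B Bs hB]]|[B]].
- by exists A; rewrite // inE eqxx.
- by exists B; rewrite // inE Bs orbT.
by rewrite inE => /predU1P[->|Bs hB]; [left|right; exists B].
Qed.

Section LayerEquiv.
Variables (L : logic) (P : seq nat).
Implicit Types (K M : model L).

Definition layer_equiv n K M (k : K) (m : M) : Prop :=
  forall A, A \in layer P n -> (forces k A <-> forces m A).

Lemma layer_equiv_le n n' K M (k : K) (m : M) :
  (n <= n')%N -> layer_equiv n' k m -> layer_equiv n k m.
Proof. by move=> /layer_mono sub h A /sub /h. Qed.

Lemma layer_equiv_sym n K M (k : K) (m : M) :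
  layer_equiv n k m -> layer_equiv n m k.
Proof. by move=> h A /h ->. Qed.

Definition true_at n K (k : K) := [seq A <- layer P n | `[< forces k A >]].
Definition false_at n K (k : K) := [seq A <- layer P n | ~~ `[< forces k A >]].

Lemma true_at_forced n K (k : K) : forces k (bigAnd (true_at n k)).
Proof.
by apply/forces_bigAnd => A; rewrite mem_filter => /andP[/asboolP].
Qed.

Lemma false_at_refuted n K (k : K) : ~ forces k (bigOr (false_at n k)).
Proof.
by move=> /forces_bigOr[A]; rewrite mem_filter => /andP[/asboolPn].
Qed.

Lemma layer_equivP n K M (k : K) (m : M) : forces m (bigAnd (true_at n k)) ->
  ~ forces m (bigOr (false_at n k)) -> layer_equiv n k m.
Proof.
move=> /forces_bigAnd h1 h2 A AP; split=> [kA|mA].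
  by apply: h1; rewrite mem_filter AP andbT; apply/asboolP.
apply: contrapT => kA; apply: h2; apply/forces_bigOr; exists A => //.
by rewrite mem_filter AP andbT; apply/asboolPn.
Qed.

Definition separator n K (k : K) :=
  Imp (bigAnd (true_at n k)) (bigOr (false_at n k)).

Lemma separator_refuted n K (k : K) : ~ forces k (separator n k).
Proof.
move=> /(_ k (le_refl k) (true_at_forced n k)); exact: false_at_refuted.
Qed.

(** The separator of [k] lies one layer above: it fails exactly where some later
    world looks like [k] up to layer [n]. *)
Lemma not_forces_separator n K M (k : K) (m : M) :
  ~ forces m (separator n k) -> exists2 m', le m m' & layer_equiv n k m'.
Proof.
move=> /existsNP[m' /not_implyP[mm' /not_implyP[h1 h2]]].
by exists m' => //; apply: layer_equivP.
Qed.

Lemma layer_equiv_forth n K M (k k' : K) (m : M) : layer_equiv n.+1 k m ->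
  le k k' -> exists2 m', le m m' & layer_equiv n k' m'.
Proof.
move=> h kk'; apply: not_forces_separator => mS.
apply: (@separator_refuted n _ k'); apply: (forces_le kk').
by apply/h => //; apply: layer_imp.
Qed.

Lemma layer_equiv_forthR n K M (k k' : K) (m : M) : layer_equiv n.+1 k m ->
  R k k' -> exists2 m', R m m' & layer_equiv n k' m'.
Proof.
move=> h kk'; apply: contrapT => no.
have /(h _ (layer_lewis _ _ _ _)) : forces m
    (Lewis (bigAnd (true_at n k')) (bigOr (false_at n k'))).
  move=> m' mm' h1; apply: contrapT => h2; apply: no; exists m' => //.
  exact: layer_equivP.
move=> /(_ k' kk' (true_at_forced n k')); exact: false_at_refuted.
Qed.

End LayerEquiv.

(** * Amalgamation *)

Lemma subformulas_self A : A \in subformulas A.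
Proof. by case: A => *; rewrite /= !inE eqxx. Qed.

Lemma subformulas_closed A D : D \in subformulas A ->
  match D with
  | And B C | Or B C | Imp B C | Lewis B C =>
      B \in subformulas A /\ C \in subformulas A
  | _ => True
  end.
Proof.
elim: A D => [i|||B IB C IC|B IB C IC|B IB C IC|B IB C IC] D /=.
1-3: by rewrite !inE orbF => /eqP->.
all: rewrite !inE => /predU1P[->|/orP[/IB|/IC]];
  first (by split; rewrite !inE !subformulas_self ?orbT);
  case: D => //= ? ? [*]; split; rewrite !inE; apply/orP; right;
    apply/orP; first [by left | by right].
Qed.

Lemma subformulas_PV A i : Var i \in subformulas A -> i \in PV A.
Proof.
elim: A => [j|||B IB C IC|B IB C IC|B IB C IC|B IB C IC] /=.
1: by rewrite !inE orbF => /eqP[->].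
1-2: by rewrite !inE.
all: by rewrite !inE/= => /orP[/IB|/IC] ->; rewrite ?orbT.
Qed.

Lemma count_lt (T : eqType) (a b : pred T) (s : seq T) z :
  subpred a b -> z \in s -> b z -> ~~ a z -> (count a s < count b s)%N.
Proof.
move=> ab zs bz az; elim: s zs => //= y s IH; rewrite inE => /predU1P[<-|/IH h].
  by rewrite bz (negPf az) add0n add1n ltnS sub_count.
by rewrite -addnS leq_add//; case: (a y) (ab y) => // ->.
Qed.

(** Semantic form of the Löb principle: a refuting successor exists at which
    [A ⤳ B] has become true, so that moving to it changes the set of true
    subformulas. *)
Lemma not_forces_lewis L (K : model L) (k : K) A B : ~ forces k (Lewis A B) ->
  exists k', [/\ R k k', forces k' A, ~ forces k' B & forces k' (Lewis A B)].
Proof.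
elim/(well_founded_ind (R_wf (m := K))): k => k IH.
move=> /existsNP[y /not_implyP[ky /not_implyP[yA yB]]].
have [h|/(IH y ky)[z [yz zA zB h]]] := pselect (forces y (Lewis A B)).
  by exists y.
by exists z; split=> //; apply: leR (R_le ky) yz.
Qed.

Section Amalgam.
Variables (L : logic) (phi : form) (q : {fset nat}) (K M : model L).

Local Notation X := (subformulas phi).
Local Notation VX := [fset B in X | var_or_arrow B].
Local Notation P := (PV phi `\` q).
Implicit Types (k : K) (m : M).

Definition agree k k' : Prop :=
  forall A, A \in X -> (forces k A <-> forces k' A).

Definition rank k : nat := count (fun A => ~~ `[< forces k A >]) VX.

Lemma rank_le k : (rank k <= nu phi)%N.
Proof. exact: count_size. Qed.

Lemma rank_lt_nu k B : B \in VX -> forces k B -> (rank k < nu phi)%N.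
Proof.
move=> BX kB; rewrite /nu -count_predT; apply: (count_lt _ BX) => //.
by rewrite negbK; apply/asboolP.
Qed.

(** The truth of a formula is determined by that of the variables and arrows
    among its subformulas. *)
Lemma agree_or_drop k k' : le k k' -> agree k k' \/ (rank k' < rank k)%N.
Proof.
move=> kk'.
have [h|/existsNP[B /not_implyP[BX /not_implyP[k'B kB]]]] :=
    pselect (forall B, B \in VX -> forces k' B -> forces k B); last first.
  right; apply: (count_lt _ BX); last by rewrite negbK; apply/asboolP.
    by move=> A /asboolPn n; apply/asboolPn => /(forces_le kk').
  exact/asboolPn.
left=> A AX; split; first exact: forces_le.
elim: A AX => [i|||B IB C IC|B IB C IC|B IB C IC|B IB C IC] AX //.
- by apply: h; rewrite !inE /= AX.
- by have [BX CX] := subformulas_closed AX => -[/(IB BX) ? /(IC CX) ?].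
- have [BX CX] := subformulas_closed AX.
  by move=> [/(IB BX) ?|/(IC CX) ?]; [left|right].
- by apply: h; rewrite !inE /= AX.
- by apply: h; rewrite !inE /= AX.
Qed.

(** The worlds of the amalgam are pairs of a world [m] of [M] and a source, which
    is [Some (k, b)] or [None].  A pair with source [Some (k, b)] should make the
    same subformulas of [phi] true as [k].  Agreement of [k] and [m] up to layer
    [2 * rank k + 1] would be too much to ask: after a step from [m] to [m'], a
    world of [K] matching [m'] agrees with it on one layer less, and this is not
    compensated if the rank has not dropped.  So [k] fully agrees only with some
    [m0] below [m], while [m] itself agrees on one layer less with some [k'] above
    [k] that has the same true subformulas.  Further steps start from [m0] again,
    hence no more layers are lost before the rank drops.

    The mark [b] records that [m] and [k'] are reached from [m0] and [k] by
    [R]-steps, so that [k'] forces [B] if it forces [A], for all [A ⤳ B] true at [k].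
    Source [None] means that there is no counterpart in [K]: such pairs form a
    copy of [M]. *)
Definition node (o : option (K * bool)) m : Prop :=
  if o is Some (k, b) then exists m0 k',
    [/\ le m0 m, le k k', agree k k' & b -> R m0 m /\ R k k'] /\
    layer_equiv P (2 * rank k).+1 k m0 /\ layer_equiv P (2 * rank k) k' m
  else True.

(** In [iSLa_plus] the formulas [A ⟶ B] with [A ⤳ B] true at [k] have to persist
    once a world is marked, so the mark may be given up only along an [R]-step. *)
Definition source_le (o o' : option (K * bool)) : Prop :=
  match o, o' with
  | None, _ => True
  | Some _, None => False
  | Some (k, b), Some (k', b') =>
      le k k' /\ (L = iSLa_plus -> b -> b' \/ R k k')
  end.

(** Either [K] itself has an [R]-step, or the target is marked; the latter allows
    an [R]-step of [M] that does not leave [k]. *)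
Definition source_R (o o' : option (K * bool)) : Prop :=
  match o, o' with
  | None, _ => True
  | Some _, None => False
  | Some (k, b), Some (k', b') => le k k' /\ (b' \/ R k k')
  end.

Lemma source_le_refl o : source_le o o.
Proof. by case: o => [[k b]|] //=; split; [exact: le_refl|left]. Qed.

Lemma source_le_trans o2 o1 o3 : source_le o1 o2 -> source_le o2 o3 -> source_le o1 o3.
Proof.
case: o1 o2 o3 => [[k1 b1]|] [[k2 b2]|] [[k3 b3]|] //= [k12 h12] [k23 h23].
split; first exact: le_trans k23.
move=> eL /(h12 eL)[/(h23 eL)[|r]|r]; [by left|right|right].
  exact: leR k12 r.
exact: Rle r k23.
Qed.

Lemma source_leR o2 o1 o3 : source_le o1 o2 -> source_R o2 o3 -> source_R o1 o3.
Proof.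
case: o1 o2 o3 => [[k1 b1]|] [[k2 b2]|] [[k3 b3]|] //= [k12 _] [k23 h23].
split; first exact: le_trans k23.
by case: h23 => [|r]; [left|right; apply: leR k12 r].
Qed.

Lemma source_Rle o2 o1 o3 : L = iSLa_plus ->
  source_R o1 o2 -> source_le o2 o3 -> source_R o1 o3.
Proof.
move=> eL; case: o1 o2 o3 => [[k1 b1]|] [[k2 b2]|] [[k3 b3]|] //=.
move=> [k12 h12] [k23 /(_ eL) h23]; split; first exact: le_trans k23.
case: h12 => [/h23[|r]|r]; [by left|right|right].
  exact: leR k12 r.
exact: Rle r k23.
Qed.

Lemma source_R_le o o' : source_R o o' -> source_le o o'.
Proof. by case: o o' => [[k b]|] [[k' b']|] //= [? ?]; split. Qed.

Definition amalgam_world : Type := {x : option (K * bool) * M | node x.1 x.2}.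
Implicit Types x y z : amalgam_world.

Definition amalgam_le x y : Prop :=
  le (sval x).2 (sval y).2 /\ source_le (sval x).1 (sval y).1.

Definition amalgam_R x y : Prop :=
  R (sval x).2 (sval y).2 /\ source_R (sval x).1 (sval y).1.

(** In the copy of [M] the variables of [q] are false, so that the copy can be
    placed below all other worlds. *)
Definition amalgam_val x i : Prop :=
  if i \in q then (if (sval x).1 is Some (k, _) then holds k i else False)
  else holds (sval x).2 i.

Lemma amalgam_R_wf : well_founded (fun x y => amalgam_R y x).
Proof.
move=> x; move Em : (sval x).2 => m.
elim/(well_founded_ind (R_wf (m := M))): m x Em => m IH x Em.
by apply: Acc_intro => y [xy _]; apply: (IH (sval y).2) => //; rewrite -Em.
Qed.

Definition amalgam : model L.
Proof.
refine (@Model L amalgam_world amalgam_le amalgam_R amalgam_val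
  _ _ _ _ amalgam_R_wf _ _).
- by move=> x; split; [exact: le_refl|exact: source_le_refl].
- move=> y x z [xy1 xy2] [yz1 yz2].
  by split; [exact: le_trans yz1|exact: source_le_trans yz2].
- move=> y x z [xy1 xy2] [yz1 yz2].
  by split; [exact: leR yz1|exact: source_leR yz2].
- by move=> x y [/R_le xy1 /source_R_le xy2].
- move=> eL y x z [xy1 xy2] [yz1 yz2].
  by split; [exact: Rle yz1|exact: source_Rle yz2].
move=> [[o m] h] [[o' m'] h'] i [/= mm' oo']; rewrite /amalgam_val /=.
case: ifP => _; last exact: holds_le.
by case: o o' oo' {h h'} => [[k b]|] [[k' b']|] //= [kk' _]; apply: holds_le.
Defined.

Definition point o m (h : node o m) : amalgam :=
  exist (fun x : option (K * bool) * M => node x.1 x.2) (o, m) h.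

Lemma node_self k m :
  layer_equiv P (2 * rank k).+1 k m -> node (Some (k, false)) m.
Proof.
move=> h; exists m, k; split; first by split=> //; exact: le_refl.
by split=> //; apply: layer_equiv_le h.
Qed.

(** Agreement of [k] with [m0] yields a world of [K] matching [m] up to layer
    [2 * rank k].  It either witnesses that [k] is a source for [m], or has
    smaller rank and is a source for [m] by itself. *)
Lemma node_forth k m0 m (c : bool) : layer_equiv P (2 * rank k).+1 k m0 ->
  le m0 m -> (c -> R m0 m) ->
  exists k' b, [/\ node (Some (k', b)) m, le k k' & c -> b \/ R k k'].
Proof.
move=> h m0m cR.
have [k' [kk' ck' h']] : exists k',
    [/\ le k k', c -> R k k' & layer_equiv P (2 * rank k) k' m].
  case: c cR => [/(_ isT) r|_].
    have [k' r' h'] := layer_equiv_forthR (layer_equiv_sym h) r.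
    by exists k'; split; [exact: R_le|by []|exact: layer_equiv_sym].
  have [k' r' h'] := layer_equiv_forth (layer_equiv_sym h) m0m.
  by exists k'; split=> //; exact: layer_equiv_sym.
have [ag|drop] := agree_or_drop kk'.
  exists k, c; split; [|exact: le_refl|by left].
  exists m0, k'; split=> //; split=> // cc.
  by split; [exact: cR|exact: ck'].
exists k', false; split=> // [|/ck']; last by right.
by apply: node_self; apply: layer_equiv_le h'; rewrite ltn_pmul2l.
Qed.

Lemma amalgam_forth x m : le (sval x).2 m ->
  exists2 y, amalgam_le x y & (sval y).2 = m.
Proof.
case: x => -[[[k b]|] m1] h1 /= m1m; last first.
  by exists (@point None m I).
have [m0 [k0 [[m01 kk0 ag bR] [e0 e1]]]] := h1.
(* Outside [iSLa_plus] an order step after [R m0 m1] is no [R]-step. *)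
pose c := b && `[< L = iSLa_plus >].
have cR : c -> R m0 m.
  by move=> /andP[/bR[r _] /asboolP eL]; apply: Rle r m1m.
have [k' [b' [h kk' cb']]] := node_forth e0 (le_trans m01 m1m) cR.
exists (point h) => //; split=> //=; split=> // eL bt.
by apply: cb'; rewrite /c bt; apply/asboolP.
Qed.

Lemma amalgam_forthR x m : R (sval x).2 m ->
  exists2 y, amalgam_R x y & (sval y).2 = m.
Proof.
case: x => -[[[k b]|] m1] h1 /= m1m; last first.
  by exists (@point None m I).
have [m0 [k0 [[m01 kk0 ag bR] [e0 e1]]]] := h1.
have r : R m0 m := leR m01 m1m.
have [k' [b' [h kk' /(_ isT) cb']]] := node_forth (c := true) e0 (R_le r) (fun=> r).
by exists (point h).
Qed.

(** The projection to [M] is a bounded morphism for all variables outside [q]. *)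
Lemma amalgam_proj A x : (forall i, i \in PV A -> i \notin q) ->
  @forces L amalgam x A <-> forces (sval x).2 A.
Proof.
elim: A x => [i|||B IB C IC|B IB C IC|B IB C IC|B IB C IC] x hq //=.
- by rewrite /amalgam_val (negPf (hq i _)) //= inE.
all: have hB i (h : i \in PV B) : i \notin q by apply: hq; rewrite /= inE h.
all: have hC i (h : i \in PV C) : i \notin q by apply: hq; rewrite /= inE h orbT.
- by rewrite IB// IC.
- by rewrite IB// IC.
- split=> h y; last by move=> [xy _]; rewrite IB// IC//; exact: h.
  by move=> /amalgam_forth[z xz <-]; rewrite -IB// -IC//; exact: h.
split=> h y; last by move=> [xy _]; rewrite IB// IC//; exact: h.
by move=> /amalgam_forthR[z xz <-]; rewrite -IB// -IC//; exact: h.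
Qed.

(** A step of [K] that drops the rank can be followed in [M]: it costs one layer,
    and the drop leaves the [2 * rank k' + 1] layers that [node_self] requires. *)
Lemma node_back n k k' m : layer_equiv P (2 * n) k m -> (rank k' < n)%N ->
  le k k' -> exists2 m', le m m' & node (Some (k', false)) m'.
Proof.
case: n => // n; rewrite mulnS add2n ltnS => h rk kk'.
have [m' mm' h'] := layer_equiv_forth h kk'; exists m' => //.
by apply: node_self; apply: layer_equiv_le h'; rewrite ltnS leq_mul2l.
Qed.

Lemma node_backR n k k' m : layer_equiv P (2 * n) k m -> (rank k' < n)%N ->
  R k k' -> exists2 m', R m m' & node (Some (k', false)) m'.
Proof.
case: n => // n; rewrite mulnS add2n ltnS => h rk kk'.
have [m' mm' h'] := layer_equiv_forthR h kk'; exists m' => //.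
by apply: node_self; apply: layer_equiv_le h'; rewrite ltnS leq_mul2l.
Qed.

Lemma layer_equiv_var n k m i : layer_equiv P n k m ->
  Var i \in X -> i \notin q -> (holds k i <-> holds m i).
Proof.
move=> h iX iq; apply: (h (Var i)); apply: (@layer_mono _ 0 n) => //=.
by apply: map_f; rewrite inE iq subformulas_PV.
Qed.

(** An arrow false at [k] is false at the witness [k'] of the node, hence refuted
    at some world above [k'].  If that world still agrees with [k], it gives
    nothing new: for an implication the node itself is a refutation, and for a
    Lewis arrow it cannot happen by [not_forces_lewis].  Otherwise the rank drops
    and [node_back] or [node_backR] places the refutation into the amalgam. *)
Lemma amalgam_forces A k b m (h : node (Some (k, b)) m) : A \in X ->
  forces (point h) A <-> forces k A.
Proof.
elim: A k b m h => [i|||B IB C IC|B IB C IC|B IB C IC|B IB C IC] k b m h AX //=.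
- rewrite /amalgam_val /=; case: ifPn => // iq.
  have [m0 [k' [[_ _ ag _] [_ e]]]] := h.
  by rewrite -(layer_equiv_var e AX iq); apply: iff_sym; apply: (ag (Var i)).
- by have [BX CX] := subformulas_closed AX; rewrite IB// IC.
- by have [BX CX] := subformulas_closed AX; rewrite IB// IC.
- have [BX CX] := subformulas_closed AX; split=> [f|f].
    have [m0 [k' [[_ kk' ag bR] [_ e]]]] := h.
    suff : forces k' (Imp B C) by move/(ag _ AX).
    move=> k1 k'k1 k1B; apply: contrapT => k1C.
    have kk1 : le k k1 := le_trans kk' k'k1.
    have [ag1|drop] := agree_or_drop kk1.
      apply: k1C; apply/(ag1 _ CX)/(IC k b m h CX); apply: f.
        exact: (@le_refl _ amalgam).
      by apply/(IB k b m h BX)/(ag1 _ BX).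
    have [m1 mm1 h1] := node_back e drop k'k1.
    apply: k1C; apply/(IC _ _ _ h1 CX); apply: f; last exact/(IB _ _ _ h1 BX).
    split=> //=; split=> // eL /bR[_ r]; right; exact: Rle r k'k1.
  move=> [[[[k1 b1]|] m1] h1] [/= mm1 // [kk1 _]].
  by move=> /(IB _ _ _ h1 BX) /(f _ kk1) /(IC _ _ _ h1 CX).
have [BX CX] := subformulas_closed AX; split=> [f|f].
  have [m0 [k' [[_ kk' ag bR] [_ e]]]] := h.
  suff : forces k' (Lewis B C) by move/(ag _ AX).
  apply: contrapT => nk'.
  have [k1 [k'k1 k1B k1C k1L]] := not_forces_lewis nk'.
  have [ag1|drop] := agree_or_drop (le_trans kk' (R_le k'k1)).
    by apply: nk'; apply/(ag _ AX)/(ag1 _ AX).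
  have [m1 mm1 h1] := node_backR e drop k'k1.
  apply: k1C; apply/(IC _ _ _ h1 CX); apply: f; last exact/(IB _ _ _ h1 BX).
  have r := leR kk' k'k1.
  by split=> //=; split; [exact: R_le|right].
move=> [[[[k1 b1]|] m1] h1] [/= mm1 // [kk1 r]].
move=> /(IB _ _ _ h1 BX) k1B; apply/(IC _ _ _ h1 CX).
case: r => [b1t|r]; last exact: f r k1B.
have [m0 [k0 [[_ _ ag bR] _]]] := h1.
have [_ r] := bR b1t.
apply/(ag _ CX); apply: (forces_le (A := Lewis B C) kk1 f k0) => //; exact/(ag _ BX).
Qed.

(** If no variable or arrow among the subformulas is true at [k], then nothing has
    to persist from [k], and a copy without full agreement can take the place of
    a node with source [k]. *)
Lemma copy_forces A k m : layer_equiv P (2 * rank k) k m ->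
  (forall B, B \in VX -> ~ forces k B) -> A \in X ->
  forces (@point None m I) A <-> forces k A.
Proof.
move=> e no.
elim: A => [i|||B IB C IC|B IB C IC|B IB C IC|B IB C IC] AX //=.
- rewrite /amalgam_val /=; case: ifPn => iq.
    by split=> // kA; apply: (no (Var i)); rewrite // !inE /= AX.
  exact: iff_sym (layer_equiv_var e AX iq).
- by have [BX CX] := subformulas_closed AX; rewrite IB// IC.
- by have [BX CX] := subformulas_closed AX; rewrite IB// IC.
- have [BX CX] := subformulas_closed AX; split=> [f|f]; last first.
    by case: (no (Imp B C)); rewrite // !inE /= AX.
  move=> k1 kk1 k1B; apply: contrapT => k1C.
  have [ag1|drop] := agree_or_drop kk1.
    apply/k1C/(ag1 _ CX)/(IC CX); apply: f; first exact: (@le_refl _ amalgam).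
    by apply/(IB BX)/(ag1 _ BX).
  have [m1 mm1 h1] := node_back e drop kk1.
  apply: k1C; apply/(amalgam_forces h1 CX); apply: f => //.
  exact/(amalgam_forces h1 BX).
have [BX CX] := subformulas_closed AX; split=> [f|f]; last first.
  by case: (no (Lewis B C)); rewrite // !inE /= AX.
apply: contrapT => nk.
have [k1 [kk1 k1B k1C k1L]] := not_forces_lewis nk.
have [ag1|drop] := agree_or_drop (R_le kk1).
  by apply: nk; apply/(ag1 _ AX).
have [m1 mm1 h1] := node_backR e drop kk1.
apply: k1C; apply/(amalgam_forces h1 CX); apply: f => //.
exact/(amalgam_forces h1 BX).
Qed.

End Amalgam.

(** * The interpolants *)

Section Interpolants.
Variables (L : logic) (phi : form) (q : {fset nat}).
Local Notation P := (PV phi `\` q).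
Implicit Types (K M : model L) (psi : form).

Lemma disjointP psi : PV psi `&` q = fset0 ->
  forall i, i \in PV psi -> i \notin q.
Proof.
move=> dis i ipsi; apply/negP => iq.
by have := in_fset0 i; rewrite -dis inE ipsi iq.
Qed.

Lemma amalgam_post K M (k : K) (m : M) psi : PV psi `&` q = fset0 ->
  layer_equiv P (2 * nu phi).+1 k m -> forces k phi -> ~ forces m psi ->
  ~ (phi ⊑[L] psi).
Proof.
move=> dis e kphi mpsi pr; apply: mpsi.
have h : node phi q (Some (k, false)) m.
  by apply: node_self; apply: layer_equiv_le e; rewrite ltnS leq_mul2l rank_le.
apply/(amalgam_proj (point h) (disjointP dis)).
have := soundness (point h) pr; move=> /(_ _ (le_refl _)); apply.
by apply/amalgam_forces => //; apply: subformulas_self.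
Qed.

(** The world of the amalgam that refutes [phi] lies above [m'], and [psi] is
    needed at [m] only: the copy of [m] is below it and inherits its failure. *)
Lemma amalgam_pre K M (k : K) (m m' : M) psi : PV psi `&` q = fset0 ->
  layer_equiv P (2 * nu phi) k m' -> le m m' -> forces m psi ->
  ~ forces k phi -> ~ (psi ⊑[L] phi).
Proof.
move=> dis e mm' mpsi kphi pr; apply: kphi.
pose root := @point L phi q K M None m I.
have rphi : forces root phi.
  have := soundness root pr; move=> /(_ _ (le_refl _)); apply.
  by apply/(amalgam_proj root (disjointP dis)).
have e' : layer_equiv P (2 * rank phi k) k m'.
  by apply: layer_equiv_le e; rewrite leq_mul2l rank_le.
have [[B BX kB]|/forall2NP no] := pselect (exists2 B,
    B \in [fset B in subformulas phi | var_or_arrow B] & forces k B).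
  have h : node phi q (Some (k, false)) m'.
    apply: node_self; apply: layer_equiv_le e.
    by rewrite ltn_pmul2l// (rank_lt_nu BX kB).
  apply/(amalgam_forces h (subformulas_self phi)).
  by apply: (forces_le _ rphi); split.
apply/(copy_forces e' _ (subformulas_self phi)).
  by move=> B BX; have [] := no B.
by apply: (forces_le _ rphi); split.
Qed.

Definition post_interpolant : form :=
  bigAnd [seq A <- layer P (2 * nu phi).+2 | `[< phi ⊑[L] A >]].

Definition pre_interpolant : form :=
  bigOr [seq bigAnd s | s <- sublists (layer P (2 * nu phi).+1)
                      & `[< bigAnd s ⊑[L] phi >]].

Lemma post_interpolantP psi : PV psi `&` q = fset0 ->
  phi ⊑[L] psi <-> post_interpolant ⊑[L] psi.
Proof.
move=> dis; split=> pr; last first.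
  apply: ent_trans pr; apply: ent_bigAnd => A.
  by rewrite mem_filter => /andP[/asboolP].
apply: contrapT => /completeness[M [m [/forces_bigAnd mE mpsi]]].
have : ~ phi ⊑[L] separator P (2 * nu phi).+1 m.
  move=> h; apply: (@separator_refuted _ P (2 * nu phi).+1 _ m); apply: mE.
  by rewrite mem_filter layer_imp andbT; apply/asboolP.
move=> /completeness[K [k [kphi /not_forces_separator[k' kk' e]]]].
apply: (amalgam_post dis (layer_equiv_sym e) _ mpsi pr).
exact: forces_le kphi.
Qed.

Lemma pre_interpolantP psi : PV psi `&` q = fset0 ->
  psi ⊑[L] phi <-> psi ⊑[L] pre_interpolant.
Proof.
move=> dis; split=> pr; last first.
  apply: ent_trans pr _; apply: bigOr_ent => A /mapP[s + ->].
  by rewrite mem_filter => /andP[/asboolP].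
apply: contrapT => /completeness[M [m [mpsi mA]]].
have : ~ bigAnd (true_at P (2 * nu phi).+1 m) ⊑[L] phi.
  move=> h; apply: mA; apply/forces_bigOr; exists (bigAnd (true_at P (2 * nu phi).+1 m)).
    by apply: map_f; rewrite mem_filter filter_sublists andbT; apply/asboolP.
  exact: true_at_forced.
move=> /completeness[K [k [/forces_bigAnd kT kphi]]].
have : ~ forces m (separator P (2 * nu phi) k).
  move=> mS; apply: (@separator_refuted _ P (2 * nu phi) _ k); apply: kT.
  by rewrite mem_filter layer_imp andbT; apply/asboolP.
move=> /not_forces_separator[m' mm' e].
exact: (amalgam_pre dis e mm' mpsi kphi pr).
Qed.

Lemma PV_post_interpolant : PV post_interpolant `<=` P.
Proof.
apply: PV_bigAnd; apply/allP => A; rewrite mem_filter => /andP[_].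
exact: PV_layer.
Qed.

Lemma PV_pre_interpolant : PV pre_interpolant `<=` P.
Proof.
apply: PV_bigOr; apply/allP => A /mapP[s + ->].
rewrite mem_filter => /andP[_ /sublists_sub sub].
by apply: PV_bigAnd; apply/allP => B /sub; apply: PV_layer.
Qed.

Lemma complexity_post_interpolant :
  (complexity post_interpolant <= 2 * nu phi + 2)%N.
Proof.
rewrite addn2; apply: complexity_bigAnd; apply/allP => A.
by rewrite mem_filter => /andP[_ /complexity_layer].
Qed.

Lemma complexity_pre_interpolant :
  (complexity pre_interpolant <= 2 * nu phi + 1)%N.
Proof.
rewrite addn1; apply: complexity_bigOr; apply/allP => A /mapP[s + ->].
rewrite mem_filter => /andP[_ /sublists_sub sub].
by apply: complexity_bigAnd; apply/allP => B /sub /complexity_layer.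
Qed.

End Interpolants.

Theorem theorem5p1 (L : logic) (phi : form) (q : {fset nat}) :
  (exists E : form,
    [/\ PV E `<=` PV phi `\` q,
        (forall psi : form, PV psi `&` q = fset0 ->
           ((L ⊢ (phi ⟶ psi)) <-> (L ⊢ (E ⟶ psi)))) &
        (complexity E <= 2 * nu phi + 2)%N])
  /\
  (exists A : form,
    [/\ PV A `<=` PV phi `\` q,
        (forall psi : form, PV psi `&` q = fset0 ->
           ((L ⊢ (psi ⟶ phi)) <-> (L ⊢ (psi ⟶ A)))) &
        (complexity A <= 2 * nu phi + 1)%N]).
Proof.
split.
  exists (post_interpolant L phi q); split.
  - exact: PV_post_interpolant.
  - exact: post_interpolantP.
  - exact: complexity_post_interpolant.
exists (pre_interpolant L phi q); split.
- exact: PV_pre_interpolant.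
- exact: pre_interpolantP.
- exact: complexity_pre_interpolant.
Qed.
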